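(* Let $L$ be an Eulerian binomial poset which is furthermore a lattice. Then $L$ is isomorphic to the Boolean algebra $\mathbb{B}_X$, where $X$ is the set of atoms of $L$.
   Context: All posets are locally finite with a unique minimal element $\hat 0$. A binomial poset is such a poset $P$ that contains an infinite chain, has every interval $[x,y]$ graded (rank function $\rho$; $[x,y]$ is an $n$-interval if $\rho(y)-\rho(x)=n$), and for every $n$ any two $n$-intervals have the same number $B(n)$ of maximal chains. A poset is Eulerian if $\mu(x,y)=(-1)^{\rho(y)-\rho(x)}$ for all $x\le y$. For a set $X$, $\mathbb{B}_X$ denotes the poset of all finite subsets of $X$ ordered by inclusion. *)

(* Defs.v *)
From HB Require Import structures.
From mathcomp Require Import all_boot all_order all_algebra.
From mathcomp Require Import finmap.
From mathcomp Require Import boolp classical_sets functions cardinality.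

Set Implicit Arguments.
Unset Strict Implicit.
Unset Printing Implicit Defensive.

Import Order.TTheory GRing.Theory.
Local Open Scope order_scope.
Local Open Scope classical_set_scope.

Definition locally_finite (d : Order.disp_t) (P : porderType d) : Prop :=
  forall x y : P, finite_set [set z | x <= z <= y].

(* [itv x y], and everything built on it, is meaningful only in a locally
   finite poset: [fset_set] sends an infinite set to [fset0]. *)
Definition itv (d : Order.disp_t) (P : porderType d) (x y : P) : {fset P} :=
  fset_set [set z | x <= z <= y].

Definition chains (d : Order.disp_t) (P : porderType d) (x y : P) :
    {fset {fset P}} :=
  [fset C in fpowerset (itv x y) | all2rel >=<%O C]%fset.

Definition maxchains (d : Order.disp_t) (P : porderType d) (x y : P) :
    {fset {fset P}} :=
  [fset C in chains x y |
    all (fun D => (C `<=` D)%fset ==> (D == C)) (chains x y)]%fset.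

Definition graded_itv (d : Order.disp_t) (P : porderType d) (x y : P) : Prop :=
  {in maxchains x y &, forall C D, #|` C| = #|` D|}.

(* A chain with n + 1 elements has length n; if [\bot, x] is graded, all its
   maximal chains attain the maximum below. *)
Definition rank (d : Order.disp_t) (P : bPOrderType d) (x : P) : nat :=
  (\max_(C <- chains \bot x) #|` C|)%N.-1.

Definition n_interval (d : Order.disp_t) (P : bPOrderType d) (n : nat)
    (x y : P) : bool :=
  (x <= y) && (rank y - rank x == n)%N.

Definition has_infinite_chain (d : Order.disp_t) (P : porderType d) : Prop :=
  exists C : set P, infinite_set C /\ total_on C (fun x y => x <= y).

Definition binomial_poset (d : Order.disp_t) (P : bPOrderType d) : Prop :=
  [/\ locally_finite P,
      has_infinite_chain P,
      forall x y : P, x <= y -> graded_itv x y &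
      exists B : nat -> nat, forall (n : nat) (x y : P),
        n_interval n x y -> #|` maxchains x y| = B n].

(* Fuelled form of mu(x, x) = 1, mu(x, y) = - \sum_(x <= z < y) mu(x, z) for
   x < y, and mu(x, y) = 0 when x is not below y; see [moebiusE]. *)
Fixpoint moebius_rec (d : Order.disp_t) (P : porderType d) (n : nat)
    (x y : P) : int :=
  if n is n'.+1 then
    if x == y then 1%R
    else (- \sum_(z <- (itv x y : seq P) | (z < y)%O) moebius_rec n' x z)%R
  else 0%R.

Definition moebius (d : Order.disp_t) (P : porderType d) (x y : P) : int :=
  moebius_rec #|` itv x y| x y.

Definition eulerian (d : Order.disp_t) (P : bPOrderType d) : Prop :=
  forall x y : P, x <= y -> moebius x y = ((-1) ^+ (rank y - rank x)%N)%R.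

Definition atoms (d : Order.disp_t) (P : bPOrderType d) : set P :=
  [set a | \bot < a /\ forall z : P, z < a -> z = \bot].
Arguments atoms {d} P _.

Definition order_isomorphic (S T : Type) (leS : rel S) (leT : rel T) : Prop :=
  exists f : S -> T, bijective f /\ {mono f : x y / leS x y >-> leT x y}.

Section LocallyFiniteTheory.
Variables (d : Order.disp_t) (P : porderType d).
Hypothesis lfP : locally_finite P.

Lemma mem_itv (x y z : P) : (z \in itv x y) = (x <= z <= y).
Proof.
rewrite /itv in_fset_set; last exact: lfP.
by apply/idP/idP; rewrite in_setE.
Qed.

Lemma card_itv_lt (x y z : P) : x <= z -> z < y ->
  (#|` itv x z| < #|` itv x y|)%N.
Proof.
move=> xz zy; apply: fproper_ltn_card; rewrite fproperE; apply/andP; split.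
  apply/fsubsetP => t; rewrite !mem_itv => /andP[-> tz] /=.
  exact: le_trans tz (ltW zy).
apply/negP => /fsubsetP /(_ y); rewrite !mem_itv lexx (lt_geF zy) !andbF andbT.
by rewrite (le_trans xz (ltW zy)) => /(_ isT).
Qed.

Lemma mem_chains (x y : P) (C : {fset P}) :
  (C \in chains x y) <->
  (forall z, z \in C -> x <= z <= y) /\
  (forall u v, u \in C -> v \in C -> u >=< v).
Proof.
rewrite !inE /= fpowersetE; split.
  move=> /andP[/fsubsetP Cxy /allrelP CC]; split=> [z /Cxy|u v uC vC].
    by rewrite mem_itv.
  exact: CC.
case=> Cxy CC; apply/andP; split.
  by apply/fsubsetP => z /Cxy; rewrite mem_itv.
by apply/allrelP => u v uC vC; apply: CC.
Qed.

Lemma mem_maxchains (x y : P) (C : {fset P}) :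
  (C \in maxchains x y) <->
  C \in chains x y /\ (forall D, D \in chains x y -> (C `<=` D)%fset -> D = C).
Proof.
rewrite /maxchains in_fset /= inE /=; split.
  move=> /andP[Cxy /allP maxC]; split=> // D Dxy CD.
  by have /= := maxC D Dxy; rewrite CD => /eqP.
case=> Cxy maxC; apply/andP; split=> //.
by apply/allP => D Dxy /=; apply/implyP => CD; apply/eqP; apply: maxC.
Qed.

Lemma moebius_rec_fuel (n m : nat) (x y : P) :
  (#|` itv x y| <= n)%N -> (#|` itv x y| <= m)%N ->
  moebius_rec n x y = moebius_rec m x y.
Proof.
have nil_itv k (u v : P) : (#|` itv u v| <= 0)%N -> moebius_rec k u v = 0%R.
  rewrite leqn0 cardfs_eq0 => /eqP uv0; case: k => //= k.
  case: eqP => [uv|_].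
    by have := mem_itv u v u; rewrite uv0 uv lexx.
  by rewrite uv0 big_nil oppr0.
elim: n m x y => [|n IHn] [|m] x y hn hm; rewrite ?(nil_itv _ _ _ hn) ?(nil_itv _ _ _ hm) //=.
case: eqP => // _; congr (- _)%R.
rewrite big_seq_cond [RHS]big_seq_cond; apply: eq_bigr => z /andP[].
rewrite mem_itv => /andP[xz _] zy.
by apply: IHn; rewrite -ltnS; apply: leq_trans (card_itv_lt xz zy) _.
Qed.

Lemma moebiusE (x y : P) :
  moebius x y =
  if x == y then 1%R
  else (- \sum_(z <- (itv x y : seq P) | (z < y)%O) moebius x z)%R.
Proof.
rewrite [LHS](@moebius_rec_fuel _ #|` itv x y|.+1) //=.
case: eqP => // _; congr (- _)%R.
rewrite big_seq_cond [RHS]big_seq_cond; apply: eq_bigr => z /andP[].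
rewrite mem_itv => /andP[xz _] zy.
by apply: moebius_rec_fuel => //; apply: ltnW (card_itv_lt xz zy).
Qed.

End LocallyFiniteTheory.

(* Main.v *)
(* Let N(y, k) be the number of elements of rank k below y. Splitting maximal
   chains at their element of rank k gives N(y, k) B(k) B(n - k) = B(n) for y of
   rank n, so the Euler relations read
     sum_k (-1)^k / (B(k) B(n - k)) = 0   for n > 0.
   They force B(n) = n!, two values at a time: if B(k) = k! for k <= 2m, the
   relation for 2m + 2 shows that an element of rank 2m + 1 has at most 2m + 1
   atoms below it, and the lattice property gives the reverse inequality. An
   element of rank n is then above exactly n atoms; taking meets, it is
   determined by them, and since 2^n elements lie below it, every set of those
   atoms occurs. *)
Require Import Defs.
From mathcomp Require Import all_boot all_order all_algebra.
From mathcomp Require Import finmap.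
From mathcomp Require Import boolp classical_sets cardinality.
From mathcomp Require Import zify ring lra.

Set Implicit Arguments.
Unset Strict Implicit.
Unset Printing Implicit Defensive.

Import Order.TTheory GRing.Theory Num.Theory.
Local Open Scope order_scope.

Lemma cardfsM (S T : choiceType) (A : {fset S}) (B : {fset T}) :
  #|` (A `*` B)%fset| = (#|` A| * #|` B|)%N.
Proof.
rewrite -(size_allpairs pair); apply/perm_size/uniq_perm => //.
  by apply: allpairs_uniq => // -[u1 u2] [v1 v2] _ _ [-> ->].
move=> [u v]; rewrite inE /=; apply/andP/allpairsP => [[uA vB]|].
  by exists (u, v).
by case=> -[u' v'] [/= uA vB [-> ->]].
Qed.

Lemma in_fset_sep (T : choiceType) (A : {fset T}) (p : pred T) x :
  (x \in [fset y in A | p y]%fset) = (x \in A) && p x.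
Proof. by rewrite !inE. Qed.

(** * Maximal chains of an interval, cut and glued at an element *)

Section MaximalChains.
Variables (d : Order.disp_t) (P : porderType d).
Hypothesis lfP : locally_finite P.
Implicit Types (x y z t : P) (C D : {fset P}).

(** Maximality can be tested one element at a time: an element comparable to all of [C] can be added
    to [C], leaving it a chain. *)
Lemma maxchainsP x y C : C \in maxchains x y <->
  C \in chains x y /\
  forall t, x <= t <= y -> (forall u, u \in C -> t >=< u) -> t \in C.
Proof.
split=> [/mem_maxchains[Cxy maxC]|[Cxy maxC]].
  split=> // t txy tC; rewrite -(maxC (t |` C)%fset) ?fset1U1 ?fsubsetU1 //.
  have [Cin CC] := (mem_chains lfP x y C).1 Cxy.
  apply/(mem_chains lfP); split=> [z /fset1UP[->|/Cin]//|u v].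
  move=> /fset1UP[->|uC] /fset1UP[->|vC].
  - exact: comparablexx.
  - exact: tC.
  - by rewrite comparable_sym tC.
  - exact: CC.
apply/mem_maxchains; split=> // D /(mem_chains lfP)[Din DD] CD.
apply/eqP; rewrite eqEfsubset CD andbT; apply/fsubsetP => t tD.
apply: maxC => [|u uC]; first exact: Din.
by apply: DD => //; apply: (fsubsetP CD).
Qed.

Lemma maxchain_itv x y C z : C \in maxchains x y -> z \in C -> x <= z <= y.
Proof. by move=> /maxchainsP[/(mem_chains lfP)[Cin _] _]; apply: Cin. Qed.

Lemma maxchain_comparable x y C z t :
  C \in maxchains x y -> z \in C -> t \in C -> z >=< t.
Proof. by move=> /maxchainsP[/(mem_chains lfP)[_ CC] _]; apply: CC. Qed.

Lemma maxchain_bot x y C : x <= y -> C \in maxchains x y -> x \in C.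
Proof.
move=> xy Cxy; apply: ((maxchainsP x y C).1 Cxy).2; rewrite ?lexx ?xy //.
move=> u uC.
by apply/le_comparable; case/andP: (maxchain_itv Cxy uC).
Qed.

Lemma maxchain_top x y C : x <= y -> C \in maxchains x y -> y \in C.
Proof.
move=> xy Cxy; apply: ((maxchainsP x y C).1 Cxy).2; rewrite ?lexx ?xy //.
move=> u uC.
by apply/ge_comparable; case/andP: (maxchain_itv Cxy uC).
Qed.

Lemma maxchain_cat x y z C D : x <= z -> z <= y ->
  C \in maxchains x z -> D \in maxchains z y ->
  (C `|` D)%fset \in maxchains x y.
Proof.
move=> xz zy Cxz Dzy; apply/maxchainsP; split.
  apply/(mem_chains lfP); split=> [t|u v].
    move=> /fsetUP[/(maxchain_itv Cxz)|/(maxchain_itv Dzy)] /andP[h1 h2].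
      by rewrite h1 (le_trans h2).
    by rewrite h2 (le_trans xz h1).
  move=> /fsetUP[uC|uD] /fsetUP[vC|vD].
  - exact: maxchain_comparable Cxz _ _.
  - apply: le_comparable; have /andP[_ uz] := maxchain_itv Cxz uC.
    by have /andP[zv _] := maxchain_itv Dzy vD; apply: le_trans uz zv.
  - apply: ge_comparable; have /andP[_ vz] := maxchain_itv Cxz vC.
    by have /andP[zu _] := maxchain_itv Dzy uD; apply: le_trans vz zu.
  - exact: maxchain_comparable Dzy _ _.
move=> t /andP[xt ty] tCD; apply/fsetUP.
have tC u : u \in C -> t >=< u by move=> uC; apply: tCD; rewrite inE uC.
have tD u : u \in D -> t >=< u by move=> uD; apply: tCD; rewrite inE uD orbT.
(* Since [z] belongs to [C], it is comparable to [t]; so [t] lies in one of the two intervals, where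
   the maximality of [C] or of [D] applies. *)
case/orP: (tC z (maxchain_top xz Cxz)) => [tz|zt]; [left|right].
  by apply: ((maxchainsP x z C).1 Cxz).2 => //; rewrite xt.
by apply: ((maxchainsP z y D).1 Dzy).2 => //; rewrite zt.
Qed.

(** An element [t <= z] is automatically comparable to the elements of [C] above [z], so the
    maximality of [C] is inherited. *)
Lemma maxchain_below x y z C : C \in maxchains x y -> z \in C ->
  [fset t in C | t <= z]%fset \in maxchains x z.
Proof.
move=> Cxy zC; have /andP[xz zy] := maxchain_itv Cxy zC.
apply/maxchainsP; split.
  apply/(mem_chains lfP); split=> [t|u v]; rewrite !inE.
    by move=> /andP[/(maxchain_itv Cxy)/andP[-> _] ->].
  by move=> /andP[uC _] /andP[vC _]; apply: maxchain_comparable Cxy _ _.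
move=> t /andP[xt tz] tC; rewrite !inE tz andbT.
apply: ((maxchainsP x y C).1 Cxy).2 => [|u uC].
  by rewrite xt (le_trans tz).
case/orP: (maxchain_comparable Cxy uC zC) => [uz|zu].
  by apply: tC; rewrite !inE uC.
exact/le_comparable/(le_trans tz).
Qed.

Lemma maxchain_above x y z C : C \in maxchains x y -> z \in C ->
  [fset t in C | z <= t]%fset \in maxchains z y.
Proof.
move=> Cxy zC; have /andP[xz zy] := maxchain_itv Cxy zC.
apply/maxchainsP; split.
  apply/(mem_chains lfP); split=> [t|u v]; rewrite !inE.
    by move=> /andP[/(maxchain_itv Cxy)/andP[_ ->] ->].
  by move=> /andP[uC _] /andP[vC _]; apply: maxchain_comparable Cxy _ _.
move=> t /andP[zt ty] tC; rewrite !inE zt andbT.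
apply: ((maxchainsP x y C).1 Cxy).2 => [|u uC].
  by rewrite (le_trans xz zt).
case/orP: (maxchain_comparable Cxy uC zC) => [uz|zu].
  exact/ge_comparable/(le_trans uz).
by apply: tC; rewrite !inE uC.
Qed.

(** Cutting at [z] and taking unions are inverse bijections between the chains through [z] and the
    pairs of chains. *)
Lemma card_maxchains_through x y z : x <= z -> z <= y ->
  #|` [fset C in maxchains x y | z \in C]%fset | =
  (#|` maxchains x z| * #|` maxchains z y|)%N.
Proof.
move=> xz zy; rewrite -cardfsM.
pose cat (p : {fset P} * {fset P}) := (p.1 `|` p.2)%fset.
have -> : [fset C in maxchains x y | z \in C]%fset =
    [fset cat p | p in maxchains x z `*` maxchains z y]%fset.
  apply/fsetP => C; apply/idP/imfsetP => [|[[C1 D1] /=]].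
    rewrite in_fset_sep => /andP[Cxy zC].
    exists ([fset t in C | t <= z]%fset, [fset t in C | z <= t]%fset).
      by rewrite in_fsetM /= (maxchain_below Cxy) ?(maxchain_above Cxy).
    apply/fsetP => t; rewrite !inE /= -andb_orr.
    case tC: (t \in C) => //=; apply/esym.
    exact: (maxchain_comparable Cxy tC zC).
  rewrite in_fsetM => /andP[C1z D1z] ->; rewrite /cat in_fset_sep /=.
  apply/andP; split; first exact: maxchain_cat C1z D1z.
  by rewrite inE (maxchain_top xz C1z).
rewrite card_in_imfset //= => -[C1 D1] [C2 D2]; rewrite !in_fsetM /cat /=.
move=> /andP[C1z D1z] /andP[C2z D2z] E.
(* Both pieces can be read off the union, because [C] and [D] meet only at [z]; this gives
   injectivity. *)
have belowE C D : C \in maxchains x z -> D \in maxchains z y ->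
    C = [fset t in C `|` D | t <= z]%fset.
  move=> Cz Dz; apply/fsetP => t; rewrite !inE.
  apply/idP/andP => [tC|[/orP[]// tD tz]].
    by rewrite tC; case/andP: (maxchain_itv Cz tC).
  have /andP[zt _] := maxchain_itv Dz tD.
  by rewrite (@le_anti _ _ t z) ?tz ?zt // (maxchain_top _ Cz).
have aboveE C D : C \in maxchains x z -> D \in maxchains z y ->
    D = [fset t in C `|` D | z <= t]%fset.
  move=> Cz Dz; apply/fsetP => t; rewrite !inE.
  apply/idP/andP => [tD|[/orP[]// tC zt]].
    by rewrite tD orbT; case/andP: (maxchain_itv Dz tD).
  have /andP[_ tz] := maxchain_itv Cz tC.
  by rewrite (@le_anti _ _ t z) ?tz ?zt // (maxchain_bot _ Dz).
congr pair; first by rewrite (belowE C1 D1) // E -belowE.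
by rewrite (aboveE C1 D1) // E -aboveE.
Qed.

Lemma chain_sub_maxchain x y C : C \in chains x y ->
  (forall D, D \in chains x y -> (#|` D| <= #|` C|)%N) -> C \in maxchains x y.
Proof.
move=> Cxy maxC; apply/mem_maxchains; split=> // D Dxy CD.
by apply/esym/eqP; rewrite eqEfcard CD maxC.
Qed.

End MaximalChains.

Lemma card_fset_sep (T : choiceType) (A : {fset T}) (p : pred T) :
  #|` [fset x in A | p x]%fset| = (\sum_(x <- A) p x)%N.
Proof.
transitivity (count p A); last by rewrite -sum1_count big_mkcond.
rewrite -size_filter; apply/perm_size/uniq_perm => //.
  exact: filter_uniq.
by move=> x; rewrite mem_filter in_fset_sep andbC.
Qed.

(** * The rank function, and counting maximal chains by their element of a given rank *)

Section Rank.
Variables (d : Order.disp_t) (P : bPOrderType d).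
Hypothesis lfP : locally_finite P.
Hypothesis gradedP : forall x y : P, x <= y -> graded_itv x y.
Implicit Types (x y z t : P) (C D : {fset P}).

Lemma fset0_chains x y : fset0 \in chains x y.
Proof. by apply/(mem_chains lfP). Qed.

Lemma ex_largest_chain x y : exists2 C, C \in chains x y &
  forall D, D \in chains x y -> (#|` D| <= #|` C|)%N.
Proof.
pose C0 : chains x y := [` fset0_chains x y]%fset.
case: (@arg_maxnP _ C0 xpredT (fun E : chains x y => #|` val E|)) => //.
move=> E _ maxE.
by exists (val E) => [|D Dxy]; [exact: valP|exact: (maxE [` Dxy]%fset)].
Qed.

Lemma ex_maxchain x y : exists C, C \in maxchains x y.
Proof.
have [C Cxy maxC] := ex_largest_chain x y.
by exists C; apply: chain_sub_maxchain.
Qed.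

Lemma card_maxchain_bot x C : C \in maxchains \bot x -> #|` C| = (rank x).+1.
Proof.
move=> Cx; have [D Dx maxD] := ex_largest_chain \bot x.
have -> : #|` C| = #|` D|.
  by apply: (gradedP (le0x x)) => //; apply: chain_sub_maxchain.
have -> : rank x = #|` D|.-1.
  congr _.-1; apply/eqP; rewrite eqn_leq; apply/andP; split.
    by apply/bigmax_leqP_seq => E Ex _; apply: maxD.
  exact: leq_bigmax_seq.
rewrite prednK // cardfs_gt0; apply/fset0Pn; exists \bot.
by apply: (maxchain_bot lfP (le0x x)); apply: chain_sub_maxchain.
Qed.

(** Prolonging [C] by a maximal chain from [\bot] to [x] gives a maximal chain from [\bot] to [y];
    the two parts share only [x]. *)
Lemma card_maxchain x y C : x <= y -> C \in maxchains x y ->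
  (rank x + #|` C|)%N = (rank y).+1.
Proof.
move=> xy Cxy; have [D Dx] := ex_maxchain \bot x.
have := cardfsUI D C.
rewrite (card_maxchain_bot Dx).
rewrite (card_maxchain_bot (maxchain_cat lfP (le0x x) xy Dx Cxy)).
have -> : (D `&` C)%fset = [fset x]%fset.
  apply/fsetP => t; rewrite !inE; apply/andP/eqP => [[tD tC]|->].
    have /andP[_ tx] := maxchain_itv lfP Dx tD.
    by have /andP[xt _] := maxchain_itv lfP Cxy tC; apply/le_anti/andP.
  by rewrite (maxchain_bot lfP xy Cxy) (maxchain_top lfP (le0x x) Dx).
by rewrite cardfs1 addn1 addSn => -[].
Qed.

Lemma ltn_rank x y : x < y -> (rank x < rank y)%N.
Proof.
move=> xy; have [C Cxy] := ex_maxchain x y.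
have := card_maxchain (ltW xy) Cxy.
suff : (1 < #|` C|)%N by lia.
have <- : #|` [fset x; y]%fset| = 2 by rewrite cardfs2 lt_eqF.
apply/fsubset_leq_card/fsubsetP => t; rewrite !inE => /orP[]/eqP->.
  exact: (maxchain_bot lfP (ltW xy)).
exact: (maxchain_top lfP (ltW xy)).
Qed.

Lemma leq_rank x y : x <= y -> (rank x <= rank y)%N.
Proof. by rewrite le_eqVlt => /predU1P[->//|/ltn_rank/ltnW]. Qed.

Lemma eq_rank_le x y : x <= y -> (rank y <= rank x)%N -> x = y.
Proof.
by rewrite le_eqVlt => /predU1P[//|/ltn_rank]; rewrite ltnNge => /negPf->.
Qed.

Lemma eq_rank_comparable x y : x >=< y -> rank x = rank y -> x = y.
Proof.
by move=> /orP[] xy E; [apply: eq_rank_le|apply/esym/eq_rank_le] => //;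
   rewrite E.
Qed.

Lemma rank0 : rank (\bot : P) = 0%N.
Proof.
have [C C0] := ex_maxchain (\bot : P) \bot.
suff : (#|` C| <= 1)%N by rewrite (card_maxchain_bot C0) ltnS leqn0 => /eqP.
rewrite -(cardfs1 (\bot : P)); apply/fsubset_leq_card/fsubsetP => t.
by move=> /(maxchain_itv lfP C0)/andP[_]; rewrite inE lex0.
Qed.

Lemma rank_eq0 x : (rank x == 0%N) = (x == \bot).
Proof.
apply/eqP/eqP => [x0|->]; last exact: rank0.
by apply/esym/eq_rank_le => //; rewrite x0.
Qed.

(** Rank is injective on a chain, and [C] has as many elements as there are values from [rank x] to
    [rank y], so each value is taken. *)
Lemma maxchain_ex_rank x y C k : x <= y -> C \in maxchains x y ->
  (rank x <= k <= rank y)%N -> exists2 z, z \in C & rank z = k.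
Proof.
move=> xy Cxy kxy.
have sizeC := card_maxchain xy Cxy.
suff /mapP[z zC ->] : k \in map (@rank _ P) C by exists z.
have uC : uniq (map (@rank _ P) C).
  rewrite map_inj_in_uniq ?fset_uniq // => u v uC vC; apply: eq_rank_comparable.
  exact: maxchain_comparable Cxy uC vC.
have [||_ ->] := uniq_min_size (s2 := iota (rank x) #|` C|) uC.
- move=> _ /mapP[z zC ->]; have /andP[xz zy] := maxchain_itv lfP Cxy zC.
  by rewrite mem_iota sizeC ltnS !leq_rank.
- by rewrite size_iota size_map.
by rewrite mem_iota sizeC ltnS.
Qed.

Lemma card_maxchain_rank x y C k : x <= y -> C \in maxchains x y ->
  (rank x <= k <= rank y)%N ->
  (\sum_(z <- itv x y | rank z == k) (z \in C))%N = 1%N.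
Proof.
move=> xy Cxy kxy; have [z zC zk] := maxchain_ex_rank xy Cxy kxy.
rewrite big_mkcond (bigD1_seq z) //=; last first.
  by rewrite (mem_itv lfP) (maxchain_itv lfP Cxy zC).
rewrite zk eqxx zC big1 // => t tz; case: eqP => // tk.
case: (boolP (t \in C)) => // tC; case/eqP: tz.
apply: eq_rank_comparable; last by rewrite tk.
exact: maxchain_comparable Cxy tC zC.
Qed.

(** Double counting of the pairs of a maximal chain and its unique element of rank [k]. *)
Lemma card_maxchains_rank x y k : x <= y -> (rank x <= k <= rank y)%N ->
  #|` maxchains x y| =
  (\sum_(z <- itv x y | rank z == k) #|` maxchains x z| * #|` maxchains z y|)%N.
Proof.
move=> xy kxy; rewrite card_fset_sum1 big_seq.
under eq_bigr => C Cxy do rewrite -(card_maxchain_rank xy Cxy kxy).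
rewrite -big_seq exchange_big /= big_seq_cond [RHS]big_seq_cond.
apply: eq_bigr => z /andP[]; rewrite (mem_itv lfP) => /andP[xz zy] _.
by rewrite -(card_maxchains_through lfP xz zy) card_fset_sep.
Qed.

End Rank.

(** Its cardinality is N(y, k); for [k = 1] it is the set of atoms below [y]. *)
Definition rank_set (d : Order.disp_t) (P : bPOrderType d) (y : P) (k : nat) :
    {fset P} :=
  [fset z in itv \bot y | rank z == k]%fset.

(** * Level numbers of a binomial poset and first values of [B] *)

Section BinomialPoset.
Variables (d : Order.disp_t) (P : bPOrderType d) (B : nat -> nat).
Hypothesis lfP : locally_finite P.
Hypothesis gradedP : forall x y : P, x <= y -> graded_itv x y.
Hypothesis infP : has_infinite_chain P.
Hypothesis BP :
  forall n (x y : P), n_interval n x y -> #|` maxchains x y| = B n.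
Implicit Types (x y z t : P) (C D : {fset P}).

Lemma mem_rank_set y k z : (z \in rank_set y k) = (z <= y) && (rank z == k).
Proof. by rewrite in_fset_sep (mem_itv lfP) le0x. Qed.

(** Values in any [nmodType] are allowed, so that both cardinalities in [nat] and the signed sum in
    [int] are covered. *)
Lemma sum_itv_rank (R : nmodType) y (F : nat -> R) :
  (\sum_(z <- itv \bot y) F (rank z) =
   \sum_(k < (rank y).+1) F k *+ #|` rank_set y k|)%R.
Proof.
rewrite big_seq.
rewrite (partition_big (fun z => inord (rank z) : 'I_(rank y).+1) xpredT) //=.
apply: eq_bigr => k _; rewrite card_fset_sep -sumrMnr [RHS]big_seq.
rewrite big_mkcondr; apply: eq_bigr => z; rewrite (mem_itv lfP) => /andP[_ zy].
rewrite -val_eqE /= inordK ?ltnS ?leq_rank //.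
by case: eqP => [->|]; rewrite ?mulr1n.
Qed.

Lemma card_itv_bot y :
  #|` itv \bot y| = (\sum_(k < (rank y).+1) #|` rank_set y k|)%N.
Proof.
rewrite card_fset_sum1 (sum_itv_rank y (fun=> 1%N)).
by apply: eq_bigr => k _; rewrite -mulr_natr mul1r natn.
Qed.

Lemma maxchains_card x y : x <= y -> #|` maxchains x y| = B (rank y - rank x).
Proof. by move=> xy; apply: BP; rewrite /n_interval xy /=. Qed.

Lemma card_rank_set y k : (k <= rank y)%N ->
  (#|` rank_set y k| * (B k * B (rank y - k)) = B (rank y))%N.
Proof.
move=> ky; have := maxchains_card (le0x y).
rewrite (rank0 lfP gradedP) subn0 => <-.
rewrite (@card_maxchains_rank _ _ lfP gradedP _ _ k) ?le0x //; last first.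
  by rewrite (rank0 lfP gradedP).
rewrite card_fset_sep big_distrl /= [RHS]big_mkcond /= big_seq [RHS]big_seq.
apply: eq_bigr => z; rewrite (mem_itv lfP) => /andP[_ zy].
case: eqP => [zk|]; last by rewrite mul0n.
by rewrite mul1n !maxchains_card ?le0x // (rank0 lfP gradedP) subn0 zk.
Qed.

(** Needed to evaluate [B] at every [n]. Among [n.+1] elements of an infinite chain, whose ranks are
    distinct, one has rank at least [n]; a maximal chain below it passes through rank [n]. *)
Lemma ex_rank n : exists y : P, rank y = n.
Proof.
have [C [Cinf Cchain]] := infP.
have [D DC Dn] := infinite_set_fset n.+1 Cinf.
have [y _ ny] : exists2 y, y \in D & (n <= rank y)%N.
  apply: contrapT => noy; move: Dn; apply/negP; rewrite -ltnNge ltnS.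
  rewrite -(size_map (@rank _ P)) -[leqRHS](size_iota 0); apply: uniq_leq_size.
    rewrite map_inj_in_uniq ?fset_uniq // => u v uD vD.
    apply: (eq_rank_comparable lfP gradedP).
    by apply/orP; apply: Cchain; apply: DC.
  move=> _ /mapP[z zD ->]; rewrite mem_iota add0n ltnNge.
  by apply/negP => nz; apply: noy; exists z.
have [E Ey] := ex_maxchain lfP (\bot : P) y.
have [|z _ zn] := maxchain_ex_rank lfP gradedP (k := n) (le0x y) Ey.
  by rewrite (rank0 lfP gradedP).
by exists z.
Qed.

Lemma B_gt0 n : (0 < B n)%N.
Proof.
have [y <-] := ex_rank n; have [C Cy] := ex_maxchain lfP (\bot : P) y.
have := maxchains_card (le0x y); rewrite (rank0 lfP gradedP) subn0 => <-.
by rewrite cardfs_gt0; apply/fset0Pn; exists C.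
Qed.

Lemma rank_set_neq0 y k : (k <= rank y)%N -> rank_set y k != fset0.
Proof.
move=> ky; rewrite -cardfs_gt0 -(ltn_pmul2r (m := B k * B (rank y - k))%N).
  by rewrite card_rank_set // mul0n B_gt0.
by rewrite muln_gt0 !B_gt0.
Qed.

Lemma B0 : B 0 = 1%N.
Proof.
(* The relation reads N B(0) B(0) = B(0), whence N B(0) = 1. *)
have := @card_rank_set \bot 0; rewrite (rank0 lfP gradedP) => /(_ isT) /eqP.
rewrite mulnA -[X in _ == X]mul1n eqn_pmul2r ?B_gt0 //.
by rewrite muln_eq1 => /andP[_ /eqP].
Qed.

Lemma B1 : B 1 = 1%N.
Proof.
have [y y1] := ex_rank 1; have := maxchains_card (le0x y).
rewrite (rank0 lfP gradedP) y1 => <-.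
have ny : \bot != y by rewrite eq_sym -(rank_eq0 lfP gradedP) y1.
(* A maximal chain here has two elements, hence consists of the endpoints alone. *)
have card2 C : C \in maxchains \bot y -> C = [fset \bot; y]%fset.
  move=> Cy; apply/esym/eqP; rewrite eqEfcard cardfs2 ny.
  rewrite (card_maxchain_bot lfP gradedP Cy) y1 leqnn andbT.
  apply/fsubsetP => t; rewrite !inE => /orP[]/eqP->.
    exact: (maxchain_bot lfP (le0x y)).
  exact: (maxchain_top lfP (le0x y)).
apply/eqP/cardfs1P; exists [fset \bot; y]%fset.
have [C Cy] := ex_maxchain lfP (\bot : P) y.
apply/fsetP => D; rewrite in_fset1; apply/idP/eqP => [/card2//|->].
by rewrite -(card2 C).
Qed.

Lemma atomE a : atoms P a <-> rank a = 1%N.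
Proof.
split=> [[a0 minA]|a1].
  have : rank_set a 1 != fset0.
    by rewrite rank_set_neq0 // lt0n (rank_eq0 lfP gradedP) -lt0x.
  case/fset0Pn => z; rewrite mem_rank_set le_eqVlt.
  case/andP=> /predU1P[->/eqP//|/minA ->].
  by rewrite (rank0 lfP gradedP).
split=> [|z /(ltn_rank lfP gradedP)].
  by rewrite lt_neqAle le0x andbT eq_sym -(rank_eq0 lfP gradedP) a1.
by rewrite a1 ltnS leqn0 (rank_eq0 lfP gradedP) => /eqP.
Qed.

(** * The Euler relations for [B] *)

Section Eulerian.
Hypothesis eulerP : eulerian P.

Lemma euler_sum n : (0 < n)%N ->
  (\sum_(k < n.+1) (-1) ^+ k / ((B k)%:R * (B (n - k)%N)%:R) = 0 :> rat)%R.
Proof.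
move=> n0; have [y yn] := ex_rank n.
have y0 : \bot != y by rewrite eq_sym -(rank_eq0 lfP gradedP) yn -lt0n.
have mu z : moebius \bot z = ((-1) ^+ rank z)%R.
  by rewrite eulerP ?le0x // (rank0 lfP gradedP) subn0.
(* This is the recursion for [moebius \bot y] with the term [z = y] moved into the sum. *)
have sum0 : (\sum_(z <- itv \bot y) (-1) ^+ rank z = 0 :> int)%R.
  have := moebiusE lfP \bot y; rewrite (negPf y0) => /eqP.
  rewrite -addr_eq0 => /eqP muE; apply: etrans muE.
  rewrite (bigD1_seq y) /= ?fset_uniq ?(mem_itv lfP) ?le0x ?lexx // mu.
  congr (_ + _)%R; rewrite big_seq_cond [RHS]big_seq_cond.
  apply: eq_big => z; last by rewrite mu.
  rewrite (mem_itv lfP) lt_neqAle le0x /=.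
  by case: (z <= y); rewrite ?andbT ?andbF.
move: sum0; rewrite sum_itv_rank yn.
move=> /(congr1 (fun m : int => m%:~R / (B n)%:R : rat)%R).
rewrite mul0r rmorph_sum /= mulr_suml => sum0; apply: etrans sum0.
apply: eq_bigr => k _.
have ky : (k <= rank y)%N by rewrite yn -ltnS.
have := card_rank_set ky; rewrite yn => <-.
rewrite rmorphMn rmorphXn /= rmorphN1 !natrM -(mulr_natr (_ ^+ _)).
have N0 : (#|` rank_set y k|%:R != 0 :> rat)%R.
  by rewrite pnatr_eq0 -lt0n cardfs_gt0 rank_set_neq0.
by rewrite [in RHS]invfM [in RHS]mulrA mulfK.
Qed.

End Eulerian.
End BinomialPoset.

(** The expansion of (1 - 1)^n divided by n!: the factorials satisfy the same relations as [B]. *)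
Lemma alternating_sum_fact n : (0 < n)%N ->
  (\sum_(k < n.+1) (-1) ^+ k / (k`!%:R * (n - k)%N`!%:R) = 0 :> rat)%R.
Proof.
move=> n0; have := exprBn (1 : rat) 1 n; rewrite subrr expr0n gtn_eqF //=.
move=> /(congr1 (fun q => q / n`!%:R)%R); rewrite mul0r mulr_suml => sum0.
apply: etrans (esym sum0); apply: eq_bigr => k _; rewrite !expr1n !mulr1.
have kn : (k <= n)%N by rewrite -ltnS.
rewrite -(bin_fact kn) -(mulr_natr (_ ^+ _)) !natrM [in RHS]invfM [in RHS]mulrA.
by rewrite mulfK // pnatr_eq0 -lt0n bin_gt0.
Qed.

(* In the difference of the alternating sums for [B] and for the factorials,
   only the terms 0, 1, n + 1, n + 2 survive:
   1 / B (n + 2) - 1 / (n + 2)! = 1 / B (n + 1) - 1 / (n + 1)!. *)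
Lemma fact_of_alternating_sum (B : nat -> nat) n a : (1 < n)%N -> ~~ odd n ->
    (forall k, (k <= n)%N -> B k = k`!) ->
    B n.+1 = (a * n`!)%N -> (n < a)%N -> (0 < B n.+2)%N ->
    (\sum_(k < n.+3) (-1) ^+ k / ((B k)%:R * (B (n.+2 - k)%N)%:R) = 0
      :> rat)%R ->
  B n.+1 = n.+1`! /\ B n.+2 = n.+2`!.
Proof.
(* From here on the original [n] is [n.+1], with the new [n] odd; the two unknown values are
   [B n.+2] and [B n.+3]. *)
case: n => // n n1 nodd Bfact Bn1 na Bn2 sumB.
have diff0 : (\sum_(k < n.+4) ((-1) ^+ k / ((B k)%:R * (B (n.+3 - k)%N)%:R) -
    (-1) ^+ k / (k`!%:R * (n.+3 - k)%N`!%:R)) = 0 :> rat)%R.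
  by rewrite sumrB sumB alternating_sum_fact // subrr.
have {diff0} : ((B n.+3)%:R^-1 - (B n.+2)%:R^-1 =
    n.+3`!%:R^-1 - n.+2`!%:R^-1 :> rat)%R.
  move: diff0; rewrite 2!big_ord_recl 2!big_ord_recr /=.
  rewrite big1 => [|[i ilt] _]; last first.
    rewrite /= /bump /= !add1n !Bfact ?subrr //; rewrite /= ?subSS; lia.
  rewrite /bump /= !add1n !subn0 !subSS !subn0 subnn subSnn.
  rewrite (Bfact 0%N) // (Bfact 1%N) //.
  rewrite -[((-1) ^+ n.+3)%R]signr_odd -[((-1) ^+ n.+2)%R]signr_odd /=.
  have -> : odd n by move: nodd; rewrite /= negbK.
  rewrite /= expr0 expr1 !mul1r !mulr1; lra.
rewrite Bn1 => inv_eq.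
(* The relation rewrites as 1 / B(n + 3) = (1 / a - 1 / (n + 3)) / (n + 1)!, and its left side is
   positive. With [n.+1 < a], only [a = n.+2] remains. *)
have an : (a < n.+3)%N.
  have F0 : (0 < n.+1`!%:R :> rat)%R by rewrite ltr0n fact_gt0.
  have a0 : (0 < a%:R :> rat)%R by rewrite ltr0n (leq_trans _ na).
  have n30 : (0 < n.+3%:R :> rat)%R by rewrite ltr0n.
  rewrite -(ltr_nat rat) -ltf_pV2 ?posrE //.
  rewrite -(ltr_pM2r (x := n.+1`!%:R^-1)%R) ?invr_gt0 //.
  have : (0 < (B n.+3)%:R^-1 :> rat)%R by rewrite invr_gt0 ltr0n.
  have -> : ((B n.+3)%:R^-1 =
      a%:R^-1 / n.+1`!%:R - n.+3%:R^-1 / n.+1`!%:R :> rat)%R.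
    have -> : ((B n.+3)%:R^-1 =
        (a * n.+1`!)%:R^-1 + n.+3`!%:R^-1 - n.+2`!%:R^-1 :> rat)%R by lra.
    rewrite (factS n.+2) (factS n.+1).
    move: F0; move: (n.+1`!) => f f0; rewrite !natrM.
    have n20 : (0 < n.+2%:R :> rat)%R by rewrite ltr0n.
    move: f0 a0 n20 n30; rewrite -(natr1 n.+2).
    move: (f%:R)%R (a%:R)%R (n.+2%:R)%R => F b c F0 b0 c0 c10; field.
    by rewrite ?lt0r_neq0.
  by rewrite subr_gt0.
have aE : a = n.+2 by apply/eqP; rewrite eqn_leq -ltnS an.
split; first by rewrite aE factS.
move: inv_eq; rewrite aE -factS => /addIr/invr_inj/eqP.
by rewrite eqr_nat => /eqP.
Qed.

(** * Atoms in a binomial lattice *)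

Section EulerianBinomialLattice.
Variables (d : Order.disp_t) (L : bLatticeType d) (B : nat -> nat).
Hypothesis lfL : locally_finite L.
Hypothesis gradedL : forall x y : L, x <= y -> graded_itv x y.
Hypothesis infL : has_infinite_chain L.
Hypothesis BL :
  forall n (x y : L), n_interval n x y -> #|` maxchains x y| = B n.
Implicit Types (x y z : L).

(** The count is B(n) / (B(1) B(n - 1)) = n! / (n - 1)! for [n] the rank of [x]. Factorial values
    are assumed only up to that rank, so that this applies within the induction proving [B_fact]. *)
Lemma card_rank1 x : (forall k, (k <= rank x)%N -> B k = k`!) ->
  #|` rank_set x 1| = rank x.
Proof.
move=> Bfact; case x0 : (rank x) => [|n].
  apply/eqP; rewrite cardfs_eq0; apply/negPn/negP => /fset0Pn[z].
  rewrite (mem_rank_set lfL) => /andP[/(leq_rank lfL gradedL) + /eqP z1].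
  by rewrite x0 z1.
have := @card_rank_set _ _ _ lfL gradedL BL x 1; rewrite x0 => /(_ isT).
rewrite subSS subn0 !Bfact ?x0 // mul1n factS => /eqP.
by rewrite eqn_pmul2r ?fact_gt0 // => /eqP.
Qed.

(** The meet of [x] and [y] lies above all the atoms below [x]; as the number of atoms is the rank,
    it has the rank of [x] and so equals [x]. *)
Lemma le_of_rank1 x y : (forall k, (k <= rank x)%N -> B k = k`!) ->
  (rank_set x 1 `<=` rank_set y 1)%fset -> x <= y.
Proof.
move=> Bfact /fsubsetP xy; have wx := leIl x y.
suff <- : x `&` y = x by apply: leIr.
apply: (eq_rank_le lfL gradedL wx).
rewrite -(card_rank1 Bfact) -card_rank1 => [|k kw]; last first.
  exact/Bfact/(leq_trans kw)/(leq_rank lfL gradedL).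
apply/fsubset_leq_card/fsubsetP => z zx; have := zx; have := xy z zx; clear zx.
by rewrite !(mem_rank_set lfL) lexI => /andP[-> _] /andP[-> ->].
Qed.

(* With at most rank x - 1 atoms below x, every coatom would lie above all of
   them, so there would be a single coatom; but there are as many coatoms as
   atoms. *)
Lemma card_rank1_ge x : (2 < rank x)%N ->
  (forall k, (k < rank x)%N -> B k = k`!) -> (rank x <= #|` rank_set x 1|)%N.
Proof.
move=> x2 Bfact; rewrite leqNgt; apply/negP => atoms_lt.
have x1 : (rank x).-1.+1 = rank x by rewrite (ltn_predK x2).
(* Multiplied by B(1) B(n - 1), with [n] the rank of [x], both numbers become B(n). *)
have coatoms_card : #|` rank_set x (rank x).-1| = #|` rank_set x 1|.
  have := card_rank_set lfL gradedL BL (leq_pred (rank x)).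
  rewrite -[in B (rank x - _)]x1 subSnn mulnC -mulnA.
  have x_gt0 := ltnW (ltnW x2).
  rewrite -(card_rank_set lfL gradedL BL x_gt0).
  rewrite subn1 mulnCA mulnA [RHS]mulnC => /eqP.
  by rewrite eqn_pmul2l ?muln_gt0 ?(B_gt0 lfL gradedL infL BL) // => /eqP.
have coatom_rank1 c : c \in rank_set x (rank x).-1 ->
    [/\ rank c = (rank x).-1, forall k, (k <= rank c)%N -> B k = k`! &
      rank_set c 1 = rank_set x 1].
  rewrite (mem_rank_set lfL) => /andP[cx /eqP c1].
  have cB k : (k <= rank c)%N -> B k = k`!.
    by move=> kc; apply: Bfact; rewrite -x1 ltnS -c1.
  split=> //; apply/eqP; rewrite eqEfcard (card_rank1 cB) c1 -ltnS x1 atoms_lt.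
  rewrite andbT; apply/fsubsetP => z; rewrite !(mem_rank_set lfL).
  by case/andP=> zc ->; rewrite (le_trans zc cx).
have /fset0Pn[c cx] := rank_set_neq0 lfL gradedL infL BL (leq_pred (rank x)).
have [c1 cB cE] := coatom_rank1 c cx.
have : #|` rank_set x 1| = (rank x).-1 by rewrite -cE card_rank1.
(* A single coatom would give [(rank x).-1 = 1], against [2 < rank x]. *)
rewrite -coatoms_card; suff -> : rank_set x (rank x).-1 = [fset c]%fset.
  by rewrite cardfs1; lia.
apply/fsetP => c'; rewrite in_fset1; apply/idP/eqP => [c'x|->//].
have [c'1 c'B c'E] := coatom_rank1 c' c'x.
by apply/le_anti/andP; split; apply: le_of_rank1 => //; rewrite cE c'E.
Qed.

(** * Determination of [B], and Boolean intervals *)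

Hypothesis eulerL : eulerian L.

Lemma B_fact n : B n = n`!.
Proof.
suff Bfact m : forall k, (k <= m.*2)%N -> B k = k`!.
  by apply: (Bfact n); rewrite -addnn leq_addr.
have B1L := B1 lfL gradedL infL BL.
have Bn0 := B_gt0 lfL gradedL infL BL.
have euler := euler_sum lfL gradedL infL BL eulerL.
elim: m => [|[|m] IHm].
- by move=> [|k] // _; apply: (B0 lfL gradedL infL BL).
(* The inductive step needs [1 < n], so this value is computed directly: the relation is 2 / B(2) -
   1 = 0. *)
- have B2 : B 2 = 2.
    have := euler 2 isT; rewrite !big_ord_recl big_ord0 /= /bump /=.
    rewrite !subn0 subSnn subnn (IHm 0%N) // B1L !add1n.
    rewrite expr0 expr1 sqrrN expr1n fact0 !mul1r !mulr1 addr0 => sum0.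
    have : ((B 2)%:R^-1 = 2^-1 :> rat)%R by lra.
    by move=> /invr_inj/eqP; rewrite eqr_nat => /eqP.
  by move=> [|[|[|k]]] // _; apply: IHm.
move=> k; rewrite doubleS => km.
(* The number of atoms below an element of rank 2m + 3 serves as the factor [a] in
   [fact_of_alternating_sum]. *)
have [x xE] := ex_rank lfL gradedL infL (m.+1.*2.+1).
have := @card_rank_set _ _ _ lfL gradedL BL x 1; rewrite xE => /(_ isT).
rewrite B1L mul1n subSS subn0 IHm // => /esym Bodd.
have atoms_gt : (m.+1.*2 < #|` rank_set x 1|)%N.
  rewrite -xE; apply: card_rank1_ge => [|j]; rewrite xE ?doubleS //.
  by rewrite -doubleS; apply: IHm.
have [||Bodd' Beven] := fact_of_alternating_sum _ _ IHm Bodd atoms_gt (Bn0 _)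
  (euler _ (ltn0Sn _)); rewrite ?odd_double ?doubleS //.
move: km; rewrite leq_eqVlt => /predU1P[->//|].
by rewrite ltnS leq_eqVlt => /predU1P[->//|]; rewrite ltnS; apply: IHm.
Qed.

Lemma card_rank_set_bin x k : (k <= rank x)%N ->
  #|` rank_set x k| = 'C(rank x, k).
Proof.
move=> kx; have := card_rank_set lfL gradedL BL kx.
rewrite !B_fact -(bin_fact kx) => /eqP.
by rewrite eqn_pmul2r ?muln_gt0 ?fact_gt0 // => /eqP.
Qed.

(* Both sides of the injection from the interval below x into the sets of atoms
   below x have 2 ^ rank x elements, so it is onto. *)
Lemma ex_rank_set1 x (S : {fset L}) : (S `<=` rank_set x 1)%fset ->
  exists z, rank_set z 1 = S.
Proof.
move=> Sx; pose f z := rank_set z 1.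
have f_inj : injective f.
  move=> y z fyz; apply/le_anti/andP; rewrite /f in fyz.
  by split; apply: le_of_rank1 => [k _|]; rewrite ?fyz // B_fact.
have card_itv : #|` itv \bot x| = (2 ^ rank x)%N.
  rewrite (card_itv_bot lfL gradedL) -[2]/(1 + 1)%N expnDn.
  apply: eq_bigr => k _; rewrite !exp1n !muln1.
  by rewrite card_rank_set_bin // -ltnS.
suff : S \in [fset f z | z in itv \bot x]%fset.
  by case/imfsetP => z _ ->; exists z.
suff -> : [fset f z | z in itv \bot x]%fset = fpowerset (rank_set x 1).
  by rewrite fpowersetE.
apply/eqP; rewrite eqEfcard card_fpowerset card_rank1 => [|k _]; last first.
  exact: B_fact.
rewrite card_imfset //= card_itv leqnn andbT.
apply/fsubsetP => _ /imfsetP[z /= zx ->].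
rewrite fpowersetE; apply/fsubsetP => a; rewrite !(mem_rank_set lfL).
move: zx; rewrite (mem_itv lfL) => /andP[_ zx] /andP[az ->].
by rewrite (le_trans az zx).
Qed.

(** * The isomorphism with the finite sets of atoms *)

Definition atoms_below x : {fset set_type (atoms L)} :=
  fset_set [set a | val a <= x]%classic.

Lemma mem_atoms_below x (a : set_type (atoms L)) :
  (a \in atoms_below x) = (val a \in rank_set x 1).
Proof.
rewrite in_fset_set ?(mem_rank_set lfL).
  have /(atomE lfL gradedL infL BL) -> := set_valP a.
  by rewrite eqxx andbT; apply/idP/idP; rewrite inE.
(* [fset_set] has its intended value only on a finite set; finiteness comes from the interval from
   [\bot] to [x], as [val] is injective. *)
apply: (@finite_preimage _ _ [set z | z <= x]%classic val).
  by move=> u v _ _; apply: val_inj.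
by apply: sub_finite_set (lfL \bot x) => z /= zx; rewrite le0x.
Qed.

Lemma rank_set1E x : rank_set x 1 = [fset val a | a in atoms_below x]%fset.
Proof.
apply/fsetP => z; apply/idP/imfsetP => [zx|[a /= + ->]]; last first.
  by rewrite mem_atoms_below.
have zatom : atoms L z.
  apply/(atomE lfL gradedL infL BL); move: zx.
  by rewrite (mem_rank_set lfL) => /andP[_ /eqP].
by exists (SigSub (mem_set zatom)); rewrite /= ?mem_atoms_below.
Qed.

Lemma atoms_below_mono : {mono atoms_below : x y / x <= y >-> (x `<=` y)%fset}.
Proof.
move=> x y; apply/fsubsetP/idP => [xy|xy a].
  apply: le_of_rank1 => [k _|]; first exact: B_fact.
  rewrite !rank_set1E; apply/fsubsetP => _ /imfsetP[a /= ax ->].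
  by apply/imfsetP; exists a => //; apply: xy.
rewrite !mem_atoms_below !(mem_rank_set lfL) => /andP[ax ->].
by rewrite (le_trans ax xy).
Qed.

Lemma atoms_below_surj (S : {fset set_type (atoms L)}) :
  exists x, atoms_below x = S.
Proof.
pose T := [fset val a | a in S]%fset.
(* The join is used as one element above all of [T]; the element with exactly these atoms then comes
   from [ex_rank_set1]. *)
have [|x xT] := @ex_rank_set1 (\join_(a <- T) a) T.
  apply/fsubsetP => a aT; rewrite (mem_rank_set lfL) joins_sup_seq //.
  case/imfsetP: aT => b _ ->; apply/eqP/(atomE lfL gradedL infL BL)/set_valP.
exists x; apply/fsetP => a; rewrite mem_atoms_below xT.
apply/imfsetP/idP => [[b /= bS /val_inj ->]//|aS].
by exists a.
Qed.

End EulerianBinomialLattice.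

Theorem theorem2p18 (d : Order.disp_t) (L : bLatticeType d)
    (L_binomial : binomial_poset L) (L_eulerian : eulerian L) :
  order_isomorphic (fun x y : L => (x <= y)%O)
    (fun A B : {fset set_type (atoms L)} => (A `<=` B)%fset).
Proof.
have [lfL infL gradedL [B BL]] := L_binomial.
have mono := atoms_below_mono lfL gradedL infL BL L_eulerian.
(* Choice turns surjectivity into a right inverse [g]; it is also a left inverse because an order
   embedding is injective. *)
have [g gK] := choice (atoms_below_surj lfL gradedL infL BL L_eulerian).
exists (@atoms_below _ L); split=> //; exists g => // x.
by apply/le_anti; rewrite -!mono gK fsubset_refl.
Qed.
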